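(* Let $\varepsilon>0$. For every sufficiently large $n$ there is a standard set $A\subset\mathbb Z_2^n$ such that \[ \lambda(A)<\varepsilon\quad\text{and}\quad \lambda^\pm(A)>\tfrac12-\varepsilon. \]
   Context: For a finite commutative group $G$ (written additively), a set $A\subset G$ is a standard set if $A=-A$ and $0\in A$. A character of $G$ is a homomorphism $\gamma:G\to\{z\in\mathbb C:|z|=1\}$; $\hat G$ is the group of characters and $\mathbf 1$ the principal character. For $f:G\to\mathbb R$, $\hat f(\gamma)=\sum_{x\in G}\gamma(x)f(x)$. For a standard set $A$, let $\mathcal S(A)$ be the set of functions $f:G\to\mathbb R$, not identically zero, with $f=0$ on $G\setminus A$, and $\mathcal S^\pm(A)$ the set of functions $f:G\to\mathbb R$, not identically zero, with $f\le 0$ on $G\setminus A$ and $f\ge 0$ on $A$. Then $\lambda(A)=\min\{f(0)/\hat f(\mathbf 1): f\in\mathcal S(A),\ \hat f(\gamma)\ge 0\ \forall\gamma\in\hat G\}$ and $\lambda^\pm(A)$ is defined the same way with $\mathcal S^\pm(A)$ in place of $\mathcal S(A)$. *)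

(* Defs.v *)
From HB Require Import structures.
From mathcomp Require Export all_boot all_order all_algebra.
From mathcomp Require Export complex.
From mathcomp Require Export boolp classical_sets reals.

Set Implicit Arguments.
Unset Strict Implicit.
Unset Printing Implicit Defensive.

Import Order.TTheory GRing.Theory Num.Theory.

Local Open Scope ring_scope.
Local Open Scope complex_scope.

Section Turan.
Variables (R : realType) (G : finZmodType).
Implicit Types (A : {set G}) (f : G -> R) (gamma : G -> R[i]).

Definition standard A : Prop :=
  A = [set - x | x in A]%SET /\ 0 \in A.

Definition character gamma : Prop :=
  (forall x y, gamma (x + y) = gamma x * gamma y) /\
  (forall x, `|gamma x| = 1).

Definition principal : G -> R[i] := fun=> 1.

Definition fourier f gamma : R[i] := \sum_(x : G) gamma x * (f x)%:C.

(* The order on R[i] is partial: 0 <= z means that z is real and nonnegative. *)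
Definition fourier_nonneg f : Prop :=
  forall gamma, character gamma -> 0 <= fourier f gamma.

Definition classS A f : Prop :=
  (exists x, f x != 0) /\ (forall x, x \notin A -> f x = 0).

Definition classSpm A f : Prop :=
  [/\ exists x, f x != 0,
      forall x, x \notin A -> f x <= 0 &
      forall x, x \in A -> 0 <= f x].

(* Division by zero yields 0 in the library, so the functions whose transform
   vanishes at the principal character (where the quotient is +oo, as f 0 > 0
   for every admissible f) have to be excluded explicitly. *)
Definition ratios (S : (G -> R) -> Prop) : set R :=
  [set r | exists f, [/\ S f, fourier_nonneg f, fourier f principal != 0 &
                         r%:C = (f 0)%:C / fourier f principal]]%classic.

Definition is_minimum (E : set R) (m : R) : Prop :=
  E m /\ (forall r, E r -> m <= r).

(* Relational, so that asserting [is_lambda A l] includes the existence of the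
   minimum; l is then unique. *)
Definition is_lambda A (l : R) : Prop := is_minimum (ratios (classS A)) l.

Definition is_lambda_pm A (l : R) : Prop := is_minimum (ratios (classSpm A)) l.

End Turan.

(* Main.v *)
(* Let wt be the Hamming weight and let A consist of 0 and of the vectors of
   weight at least n - d, where d is a small multiple of n.

   If f belongs to S^pm(A) and has a nonnegative transform, then
   2 sum_x wt(x) f(x) <= n sum_x f(x), because 2 wt is the sum of 1 - chi over
   the n coordinate characters chi. On the other hand (n - d - wt(x)) f(x) <= 0
   for every x <> 0. Together these give (n/2 - d) sum f <= (n - d) f(0), so
   lambda^pm(A) >= 1/2 - d/n.

   For lambda(A), the inverse transform of p(wt), with p a polynomial of degree
   at most d, is supported on the weights at most d, and translating it by
   (1, ..., 1) moves the support into A. Take for p the Chebyshev polynomial T_d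
   after an affine substitution sending the weights 1, ..., n into [-1, 1] and
   the weight 0 to 1 + 2/n. Adding the point mass at 0 makes the transform
   nonnegative, and its principal value is 1 + T_d(1 + 2/n) >= 2 + 2 d^2 / n.

   The minima exist by compactness: positive definite functions satisfy
   |f| <= f(0), so those with f(0) = 1 lie in a cube. *)

Require Import Defs.
From mathcomp Require Import all_boot all_order all_algebra.
From mathcomp Require Import reals.
From mathcomp Require Import topology normedtype derive ring lra zify.

Set Implicit Arguments.
Unset Strict Implicit.
Unset Printing Implicit Defensive.

Import Order.TTheory GRing.Theory Num.Theory.
Import numFieldNormedType.Exports.

Local Open Scope ring_scope.

Section ChebyshevPolynomial.
Variable R : comNzRingType.
Implicit Types (z : R) (k : nat).

Fixpoint chebyshev k : {poly R} :=
  if k is k1.+1 then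
    if k1 is k2.+1 then 2 *: ('X * chebyshev k1) - chebyshev k2 else 'X
  else 1.

Lemma chebyshevSS k :
  chebyshev k.+2 = 2 *: ('X * chebyshev k.+1) - chebyshev k.
Proof. by []. Qed.

Lemma size_chebyshev k : (size (chebyshev k) <= k.+1)%N.
Proof.
suff /andP[] : (size (chebyshev k) <= k.+1)%N
  && (size (chebyshev k.+1) <= k.+2)%N by [].
elim: k => [|k /andP[Tk TSk]]; first by rewrite /= size_poly1 size_polyX.
rewrite TSk chebyshevSS (leq_trans (size_polyD _ _)) // geq_max size_polyN.
apply/andP; split; last by rewrite (leq_trans Tk) // -addn2 leq_addr.
rewrite (leq_trans (size_scale_leq _ _)) // (leq_trans (size_polyMleq _ _)) //.
by rewrite size_polyX.
Qed.

Lemma horner_chebyshev0 z : (chebyshev 0).[z] = 1.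
Proof. by rewrite /= hornerE. Qed.

Lemma horner_chebyshev1 z : (chebyshev 1).[z] = z.
Proof. by rewrite /= hornerE. Qed.

Lemma horner_chebyshevSS z k :
  (chebyshev k.+2).[z] = 2 * z * (chebyshev k.+1).[z] - (chebyshev k).[z].
Proof.
by rewrite chebyshevSS hornerD hornerN hornerZ hornerM hornerX mulrA.
Qed.

(* [u] is the value at [z] of the polynomial of the second kind of degree
   [k - 1]. *)
Lemma chebyshev_pell z k : exists u,
  (chebyshev k).[z] ^+ 2 + (1 - z ^+ 2) * u ^+ 2 = 1 /\
  (chebyshev k.+1).[z] = z * (chebyshev k).[z] - (1 - z ^+ 2) * u.
Proof.
elim: k => [|k [u [pell stepE]]].
  by exists 0; rewrite horner_chebyshev0 horner_chebyshev1; split; ring.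
exists ((chebyshev k).[z] + z * u); rewrite horner_chebyshevSS stepE.
by split; [rewrite -[RHS]pell|]; ring.
Qed.

End ChebyshevPolynomial.

Section ChebyshevBounds.
Variable R : realDomainType.
Implicit Types (z t : R) (k : nat).

Lemma norm_chebyshev_le1 z k : `|z| <= 1 -> `|(chebyshev R k).[z]| <= 1.
Proof.
move=> z1; have [u [pell _]] := chebyshev_pell z k.
rewrite -(@ler_sqr _ `|_|) ?nnegrE // real_normK ?num_real // expr1n -pell.
rewrite lerDl mulr_ge0 ?sqr_ge0 // subr_ge0.
by rewrite -real_normK ?num_real // expr_le1.
Qed.

Lemma chebyshev_ge t k : 0 <= t -> 1 + k%:R ^+ 2 * t <= (chebyshev R k).[1 + t].
Proof.
move=> t0; pose T j := (chebyshev R j).[1 + t].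
suff [] : 1 + k%:R ^+ 2 * t <= T k /\ (2 * k%:R + 1) * t <= T k.+1 - T k by [].
elim: k => [|k [Tk dTk]].
  by rewrite /T horner_chebyshev0 horner_chebyshev1; split; lra.
have TSk : 1 + k.+1%:R ^+ 2 * t <= T k.+1 by rewrite -natr1; lra.
split=> //; rewrite [T k.+2]horner_chebyshevSS -/(T _) -/(T _) -natr1.
have : 0 <= t * (T k.+1 - 1).
  rewrite mulr_ge0 // subr_ge0 (le_trans _ TSk) // lerDl mulr_ge0 //.
  exact: sqr_ge0.
by lra.
Qed.

End ChebyshevBounds.

Section HammingWeight.
Variables (V : nmodType) (n : nat).
Implicit Types x y : 'rV[V]_n.

Definition hamming_weight x : nat := #|[set i | x 0 i != 0]%SET|.

Lemma hamming_weight_eq0 x : (hamming_weight x == 0%N) = (x == 0).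
Proof.
rewrite cards_eq0; apply/eqP/eqP => [x0|->].
  apply/rowP => i; apply/eqP; rewrite mxE.
  by move/setP/(_ i): x0; rewrite !inE => /negbFE.
by apply/setP => i; rewrite !inE mxE eqxx.
Qed.

Lemma hamming_weight0 : hamming_weight 0 = 0%N.
Proof. by apply/eqP; rewrite hamming_weight_eq0. Qed.

Lemma hamming_weight_le x : (hamming_weight x <= n)%N.
Proof. by rewrite -[leqRHS]card_ord max_card. Qed.

Lemma hamming_weight_const (a : V) :
  a != 0 -> hamming_weight (const_mx a) = n.
Proof.
move=> a0; rewrite -[RHS]card_ord -cardsT; congr #|pred_of_set _|.
by apply/setP => i; rewrite !inE mxE a0.
Qed.

Lemma hamming_weightD x y :
  (hamming_weight (x + y) <= hamming_weight x + hamming_weight y)%N.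
Proof.
apply: leq_trans (leq_card_setU _ _); apply/subset_leq_card/subsetP => i.
rewrite !inE mxE -negb_and; apply: contra => /andP[/eqP-> /eqP->].
by rewrite addr0.
Qed.

End HammingWeight.

Lemma hamming_weight_delta (A : nzSemiRingType) n (i : 'I_n) :
  hamming_weight ('e_i : 'rV[A]_n) = 1%N.
Proof.
apply: etrans (cards1 i); congr #|pred_of_set _|; apply/setP => j.
by rewrite !inE mxE eqxx; case: (j == i); rewrite ?oner_eq0 ?eqxx.
Qed.

Section Z2Sign.
Variable R : numDomainType.

Definition Z2sign (a : 'Z_2) : R := (-1) ^+ a.

Lemma Z2_neq0 (a : 'Z_2) : a != 0 -> a = 1.
Proof. by case: a => -[|[|//]] // ? _; apply/val_inj. Qed.

Lemma Z2signD a b : Z2sign (a + b) = Z2sign a * Z2sign b.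
Proof. by rewrite /Z2sign -exprD /= -[LHS]signr_odd modn2 oddb signr_odd. Qed.

Lemma norm_Z2sign a : `|Z2sign a| = 1.
Proof. exact: normr_sign. Qed.

Lemma Z2signE a : Z2sign a = 1 - 2 * (a != 0)%:R.
Proof.
have [->|/Z2_neq0->] := eqVneq a 0; rewrite /Z2sign /= ?expr0 ?expr1; ring.
Qed.

End Z2Sign.

Section Walsh.
Variables (R : realFieldType) (n : nat).
Local Notation G := 'rV['Z_2]_n.
Implicit Types (f g : G -> R) (a : R) (x y z : G) (i : 'I_n).

Lemma cube_addxx x : x + x = 0.
Proof.
apply/rowP => i; rewrite !mxE.
by have [->|/Z2_neq0->] := eqVneq (x 0 i) 0; apply/val_inj.
Qed.

Lemma cube_opp x : - x = x.
Proof. by apply/eqP; rewrite eq_sym -addr_eq0 cube_addxx. Qed.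

Lemma hamming_weight_flip x i :
  (hamming_weight x <= (hamming_weight (x + 'e_i)).+1)%N.
Proof.
rewrite -{1}[x]addr0 -(cube_addxx 'e_i) addrA.
by rewrite (leq_trans (hamming_weightD _ _)) // hamming_weight_delta addn1.
Qed.

Lemma hamming_weight_antipode x :
  (n <= hamming_weight (x + const_mx 1%R) + hamming_weight x)%N.
Proof.
rewrite -{1}(hamming_weight_const n (oner_neq0 'Z_2)).
have {1}-> : const_mx 1 = (x + const_mx 1) + x :> G.
  by rewrite addrAC cube_addxx add0r.
exact: hamming_weightD.
Qed.

Definition chi y x : R := \prod_i Z2sign R (y 0 i * x 0 i).

Lemma chiC y x : chi y x = chi x y.
Proof. by apply: eq_bigr => i _; rewrite mulrC. Qed.

Lemma chiDr x y z : chi x (y + z) = chi x y * chi x z.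
Proof.
by rewrite -big_split; apply: eq_bigr => i _; rewrite mxE mulrDr Z2signD.
Qed.

Lemma chiDl x y z : chi (x + y) z = chi x z * chi y z.
Proof. by rewrite ![chi _ z]chiC chiDr. Qed.

Lemma norm_chi y x : `|chi y x| = 1.
Proof. by rewrite normr_prod big1 // => i _; exact: norm_Z2sign. Qed.

Lemma chi0 y : chi y 0 = 1.
Proof. by apply: big1 => i _; rewrite mxE mulr0. Qed.

Lemma chi_delta y i : chi y 'e_i = 1 - 2 * (y 0 i != 0)%:R.
Proof.
rewrite /chi (bigD1 i) //= big1 => [|j /negPf ji].
  by rewrite mxE !eqxx !mulr1 Z2signE.
by rewrite mxE ji mulr0.
Qed.

Lemma double_hamming_weight x :
  2 * (hamming_weight x)%:R = \sum_i (1 - chi x 'e_i).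
Proof.
rewrite /hamming_weight -sum1_card natr_sum mulr_sumr big_mkcond.
by apply: eq_bigr => i _; rewrite inE chi_delta; case: (_ != 0) => /=; ring.
Qed.

Lemma sum_chi x : \sum_y chi x y = #|G|%:R * (x == 0)%:R.
Proof.
have [->|/rV0Pn[i xi]] := eqVneq x 0.
  by under eq_bigr do rewrite chiC chi0; rewrite sumr_const mulr1.
have chi_flip : chi x 'e_i = -1 by rewrite chi_delta xi /=; ring.
have : \sum_y chi x y = - \sum_y chi x y.
  rewrite [LHS](reindex_inj (addrI 'e_i)) -sumrN.
  by apply: eq_bigr => y _; rewrite chiDr chi_flip mulN1r.
by rewrite mulr0; lra.
Qed.

Definition walsh f y : R := \sum_x chi y x * f x.

Lemma walsh_at0 f : walsh f 0 = \sum_x f x.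
Proof. by apply: eq_bigr => x _; rewrite chiC chi0 mul1r. Qed.

Lemma walsh_delta z y : walsh (fun x => (x == z)%:R) y = chi y z.
Proof.
rewrite /walsh (bigD1 z) //= eqxx mulr1 big1 ?addr0 // => x /negPf->.
by rewrite mulr0.
Qed.

Lemma walshD f g y : walsh (fun x => f x + g x) y = walsh f y + walsh g y.
Proof. by rewrite -big_split; apply: eq_bigr => x _; rewrite mulrDr. Qed.

Lemma walshZ a f y : walsh (fun x => a * f x) y = a * walsh f y.
Proof. by rewrite mulr_sumr; apply: eq_bigr => x _; rewrite mulrCA. Qed.

Lemma walsh_modulation f z y :
  walsh (fun x => chi x z * f x) y = walsh f (y + z).
Proof. by apply: eq_bigr => x _; rewrite mulrA chiDl [chi x z]chiC. Qed.

Lemma walsh_translation f z y :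
  walsh (fun x => f (x + z)) y = chi y z * walsh f y.
Proof.
rewrite /walsh (reindex_inj (addIr z)) mulr_sumr; apply: eq_bigr => x _.
by rewrite -addrA cube_addxx addr0 chiDr mulrCA mulrA.
Qed.

Lemma walshK f x : walsh (walsh f) x = #|G|%:R * f x.
Proof.
rewrite {1}/walsh; under eq_bigr do rewrite mulr_sumr.
rewrite exchange_big (bigD1 x) //= [X in _ + X]big1 ?addr0 => [|z zx].
  under eq_bigr do rewrite mulrA chiC -chiDr cube_addxx chi0 mul1r.
  by rewrite sumr_const mulr_natl.
under eq_bigr do rewrite mulrA [chi _ z]chiC -chiDl.
rewrite -mulr_suml sum_chi addr_eq0 cube_opp eq_sym (negPf zx).
by rewrite mulr0 mul0r.
Qed.

Definition positive_definite f : Prop := forall y, 0 <= walsh f y.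

Lemma positive_definite_norm_le f x : positive_definite f -> `|f x| <= f 0.
Proof.
move=> f_pd; have G_gt0 : 0 < #|G|%:R :> R.
  by rewrite ltr0n; apply/card_gt0P; exists 0.
rewrite -(ler_pM2l G_gt0) -[X in X * _](gtr0_norm G_gt0) -normrM -!walshK.
rewrite (le_trans (ler_norm_sum _ _ _)) // walsh_at0; apply: ler_sum => y _.
by rewrite normrM norm_chi mul1r ger0_norm.
Qed.

Lemma walsh_weightM f y :
  2 * walsh (fun x => (hamming_weight x)%:R * f x) y =
    \sum_i (walsh f y - walsh f (y + 'e_i)).
Proof.
under eq_bigr do rewrite -walsh_modulation /walsh -sumrB.
rewrite exchange_big mulr_sumr; apply: eq_bigr => x _ /=.
rewrite mulrCA [2 * _]mulrA double_hamming_weight mulr_suml mulr_sumr.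
by apply: eq_bigr => i _; ring.
Qed.

(* Multiplication by the weight moves the transform to neighbouring vertices
   only, and the transform of a constant lives at the vertex 0. *)
Lemma walsh_poly_weight_eq0 (p : {poly R}) y : (size p <= hamming_weight y)%N ->
  walsh (fun x => p.[(hamming_weight x)%:R]) y = 0.
Proof.
elim/poly_ind: p y => [|p c IHp] y.
  by rewrite /walsh big1 // => x _; rewrite horner0 mulr0.
rewrite size_MXaddC; case: ifP => [/andP[/eqP-> /eqP->] _|_ size_p].
  by rewrite /walsh big1 // => x _; rewrite mul0r addr0 horner0 mulr0.
have -> : walsh (fun x => (p * 'X + c%:P).[(hamming_weight x)%:R]) y =
    walsh (fun x => (hamming_weight x)%:R * p.[(hamming_weight x)%:R]) y
    + c * \sum_x chi y x.
  rewrite /walsh mulr_sumr -big_split; apply: eq_bigr => x _ /=.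
  by rewrite hornerMXaddC; ring.
rewrite sum_chi -hamming_weight_eq0 (gtn_eqF (leq_ltn_trans _ size_p)) //.
rewrite !mulr0 addr0; apply: (@mulfI _ 2); first by rewrite pnatr_eq0.
rewrite mulr0 walsh_weightM big1 // => i _.
rewrite (IHp y (ltnW size_p)) sub0r IHp ?oppr0 //.
by rewrite -ltnS (leq_trans size_p) // hamming_weight_flip.
Qed.

Lemma positive_definite_sum_weight f : positive_definite f ->
  2 * \sum_x (hamming_weight x)%:R * f x <= n%:R * \sum_x f x.
Proof.
move=> f_pd; rewrite -!walsh_at0 walsh_weightM.
have -> : n%:R * walsh f 0 = \sum_(i < n) walsh f 0.
  by rewrite sumr_const card_ord mulr_natl.
by apply: ler_sum => i _; rewrite gerBl.
Qed.

End Walsh.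

Section CubeCharacters.
Variables (R : realType) (n : nat).
Local Notation G := 'rV['Z_2]_n.
Implicit Types (f : G -> R) (gamma : G -> R[i]).
Local Open Scope complex_scope.

Lemma character_chi y : character (fun x : G => (chi R y x)%:C).
Proof.
split=> [x z|x]; first by rewrite chiDr rmorphM.
by rewrite normc_def /= expr0n addr0 sqrtr_sqr norm_chi.
Qed.

Lemma character_eq_chi gamma :
  character gamma -> exists y, gamma = (fun x => (chi R y x)%:C).
Proof.
move=> [gammaD norm_gamma].
have gamma0 : gamma 0 = 1.
  have gamma0_neq0 : gamma 0 != 0 by rewrite -normr_eq0 norm_gamma oner_eq0.
  by apply: (mulfI gamma0_neq0); rewrite -gammaD addr0 mulr1.
have gamma_pm1 x : gamma x != 1 -> gamma x = -1.
  have /eqP : gamma x ^+ 2 = 1 by rewrite expr2 -gammaD cube_addxx.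
  by rewrite sqrf_eq1 => /predU1P[->|/eqP//]; rewrite eqxx.
pose y : G := \row_i (gamma 'e_i != 1)%:R.
have gamma_line i (a : 'Z_2) : gamma (a *: 'e_i) = (Z2sign R (y 0 i * a))%:C.
  have [->|/Z2_neq0->] := eqVneq a 0; first by rewrite scale0r mulr0.
  rewrite scale1r mulr1 mxE.
  by have [->|/gamma_pm1->] := eqVneq; rewrite /Z2sign /= ?expr1 ?rmorphN.
exists y; apply/funext => x; rewrite [in LHS](row_sum_delta x).
rewrite (big_morph gamma gammaD gamma0) rmorph_prod.
by apply: eq_bigr => i _; exact: gamma_line.
Qed.

Lemma fourier_chi f y : fourier f (fun x => (chi R y x)%:C) = (walsh f y)%:C.
Proof. by rewrite rmorph_sum; apply: eq_bigr => x _; rewrite rmorphM. Qed.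

Lemma fourier_principal f : fourier f (@principal R G) = (\sum_x f x)%:C.
Proof. by rewrite rmorph_sum; apply: eq_bigr => x _; rewrite mul1r. Qed.

Lemma fourier_nonnegP f : fourier_nonneg f <-> positive_definite f.
Proof.
split=> [f_nonneg y|f_pd gamma /character_eq_chi[y ->]].
  by have := f_nonneg _ (character_chi y); rewrite fourier_chi lecR.
by rewrite fourier_chi lecR.
Qed.

Lemma ratiosP (S : (G -> R) -> Prop) r : ratios S r <->
  exists f, [/\ S f, positive_definite f, 0 < \sum_x f x &
                r = f 0 / \sum_x f x].
Proof.
split=> -[f]; rewrite ?fourier_principal.
  move=> [Sf /fourier_nonnegP f_pd sum_neq0]; rewrite -fmorph_div => rE.
  exists f; split=> //; last exact: complexI.
  rewrite lt_def -{2}walsh_at0 f_pd andbT.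
  by apply: contraNneq sum_neq0 => ->.
move=> [Sf f_pd sum_gt0 ->]; exists f; rewrite fourier_principal; split=> //.
- exact/fourier_nonnegP.
- by rewrite fmorph_eq0 gt_eqF.
- by rewrite fmorph_div.
Qed.

End CubeCharacters.

Section MinimalRatio.
Variables (R : realType) (n : nat).
Local Notation G := 'rV['Z_2]_n.
Local Notation topG := (prod_topology (fun _ : G => R : topologicalType)).
Implicit Types (f : G -> R) (C : G -> set R).
Local Open Scope classical_set_scope.

Definition cone_class C f : Prop := (exists x, f x != 0) /\ forall x, C x (f x).

Definition normalized_class C : set topG :=
  [set f | forall x, C x (f x)] `&` [set f | positive_definite f]
    `&` [set f | f 0 = 1].

Lemma evaluation_continuous x : continuous (fun f : topG => f x).
Proof. by move=> f; exact: (@proj_continuous G (fun=> R) x f). Qed.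

Lemma walsh_continuous y : continuous (fun f : topG => walsh f y).
Proof.
have term_continuous x : continuous (fun f : topG => chi R y x * f x).
  move=> f; apply: (cvg_comp (fun f : topG => f x) ( *%R (chi R y x))).
    exact: evaluation_continuous.
  exact: mulrl_continuous.
exact: (@continuous_big R G +%R 0 xpredT (@add_continuous R) topG _
  (fun x f => chi R y x * f x) (fun x _ => term_continuous x)).
Qed.

Lemma closed_pointwise (F : G -> topG -> R) (D : G -> set R) :
  (forall x, continuous (F x)) -> (forall x, closed (D x)) ->
  closed [set f | forall x, D x (F x f)].
Proof.
move=> F_continuous D_closed.
have -> : [set f | forall x, D x (F x f)] = \bigcap_x (F x @^-1` D x).
  by apply/seteqP; split=> f Df x; [move=> _|]; exact: (Df x).
by apply: closed_bigI => x _; exact: preimage_closed.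
Qed.

Lemma normalized_class_compact C :
  (forall x, closed (C x)) -> compact (normalized_class C).
Proof.
move=> C_closed.
apply: (@subclosed_compact _ _ [set f : topG | forall x, `[-1, 1] (f x)]).
- apply: closedI; first apply: closedI.
  + exact: closed_pointwise evaluation_continuous C_closed.
  + exact: closed_pointwise walsh_continuous (fun=> @closed_ge R 0).
  + apply: (@preimage_closed topG R (fun f => f 0) [set 1]).
      by move=> f _; exact: evaluation_continuous.
    exact: closed_eq.
- apply: (@tychonoff G (fun=> R) (fun=> `[-1, 1])) => _.
  exact: segment_compact.
- move=> f [[_ f_pd] f_at0] x /=; rewrite in_itv /= -ler_norml.
  by rewrite -[leRHS]f_at0 positive_definite_norm_le.
Qed.

Lemma normalized_class_max C :
  (forall x, closed (C x)) -> (forall x, C x 0) -> C 0 1 ->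
  exists2 f, normalized_class C f &
    0 < \sum_x f x /\
    forall g, normalized_class C g -> \sum_x g x <= \sum_x f x.
Proof.
move=> C_closed C_0 C0_1; pose point_mass (x : G) : R := (x == 0)%:R.
have point_mass_class : normalized_class C point_mass.
  split; last by rewrite /= /point_mass eqxx.
  split=> [x|y]; last by rewrite walsh_delta chi0.
  by rewrite /point_mass; case: eqP => [->|].
have [|||f /set_mem f_class f_max] := @compact_EVT_max topG R
  (fun f => walsh f 0) (normalized_class C).
- by exists point_mass.
- exact: normalized_class_compact.
- by apply: continuous_subspaceT; exact: walsh_continuous.
exists f => //; rewrite -walsh_at0; split=> [|g g_class].
  apply: lt_le_trans (f_max _ (mem_set point_mass_class)).
  by rewrite walsh_delta chi0.
by rewrite -walsh_at0 f_max //; exact: mem_set.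
Qed.

Lemma ratios_minimum C :
  (forall x, closed (C x)) -> (forall x a t, 0 <= a -> C x t -> C x (a * t)) ->
  (forall x, C x 0) -> C 0 1 ->
  exists l, is_minimum (ratios (cone_class C)) l.
Proof.
move=> C_closed C_scale C_0 C0_1.
have [h [[Ch h_pd] h_at0] [sum_gt0 h_max]] :=
  normalized_class_max C_closed C_0 C0_1.
exists (\sum_x h x)^-1; split.
  apply/ratiosP; exists h; rewrite h_at0 mul1r; split=> //.
  by split=> //; exists 0; rewrite h_at0 oner_eq0.
move=> r /ratiosP[f [[[z fz] Cf] f_pd sumf_gt0 ->]].
have f0_gt0 : 0 < f 0.
  by apply: lt_le_trans (positive_definite_norm_le z f_pd); rewrite normr_gt0.
rewrite -[leRHS]invf_div lef_pV2 ?posrE ?divr_gt0 // mulrC mulr_sumr.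
apply: h_max; split; last by rewrite /= mulVf ?gt_eqF.
by split=> [x|y]; [apply: C_scale|rewrite /= walshZ mulr_ge0];
  rewrite // invr_ge0 ltW.
Qed.

Lemma is_lambda_exists (A : {set G}) : 0 \in A -> exists l : R, is_lambda A l.
Proof.
move=> A0; pose C x : set R := if x \in A then [set: R] else [set 0].
have classS_cone : classS A = cone_class C.
  apply/funext => f; apply/propext; split=> -[f_neq0 fA]; split=> // x.
    by rewrite /C; case: ifPn => // /fA.
  by move=> /negPf xA; have := fA x; rewrite /C xA.
rewrite /is_lambda classS_cone; apply: ratios_minimum; rewrite /C ?A0 // => x.
- by case: ifP => _; [exact: closedT|exact: closed_eq].
- by move=> a t _; case: ifP => // _ ->; rewrite /= mulr0.
- by case: ifP.
Qed.

Lemma is_lambda_pm_exists (A : {set G}) :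
  0 \in A -> exists l : R, is_lambda_pm A l.
Proof.
move=> A0.
pose C x : set R := if x \in A then [set t | 0 <= t] else [set t | t <= 0].
have classSpm_cone : classSpm A = cone_class C.
  apply/funext => f; apply/propext; split=> [[f_neq0 fN fP]|[f_neq0 fC]].
    by split=> // x; rewrite /C; case: ifPn => [/fP|/fN].
  by split=> // x; have := fC x; rewrite /C; case: (x \in A).
rewrite /is_lambda_pm classSpm_cone; apply: ratios_minimum;
  rewrite /C ?A0 //= => x.
- by case: ifP => _; [exact: closed_ge|exact: closed_le].
- move=> a t a_ge0; case: ifP => _ /= t_sign; first exact: mulr_ge0.
  exact: mulr_ge0_le0.
- by case: ifP => /=.
Qed.

End MinimalRatio.

Section PointedAntipodalBall.
Variables (R : realType) (n : nat).
Local Notation G := 'rV['Z_2]_n.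
Implicit Types (x y : G) (p : {poly R}) (t l : R) (d : nat).

Lemma standard_cube (A : {set G}) : 0 \in A -> standard A.
Proof.
split=> //; rewrite -[LHS]imset_id.
by apply: eq_imset => x; rewrite cube_opp.
Qed.

Definition pointed_antipodal_ball d : {set G} :=
  [set x | (x == 0) || (n <= hamming_weight x + d)%N]%SET.

Lemma pointed_antipodal_ball0 d : 0 \in pointed_antipodal_ball d.
Proof. by rewrite inE eqxx. Qed.

Definition weight_kernel p x : R :=
  #|G|%:R^-1 * walsh (fun y => p.[(hamming_weight y)%:R]) (x + const_mx 1).

Lemma walsh_weight_kernel p y :
  walsh (weight_kernel p) y = chi R y (const_mx 1) * p.[(hamming_weight y)%:R].
Proof.
have G_neq0 : #|G|%:R != 0 :> R.
  by rewrite pnatr_eq0 -lt0n; apply/card_gt0P; exists 0.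
by rewrite walshZ walsh_translation walshK mulrCA mulKf.
Qed.

Lemma weight_kernel_eq0 p x :
  (hamming_weight x + size p <= n)%N -> weight_kernel p x = 0.
Proof.
move=> size_p; rewrite /weight_kernel walsh_poly_weight_eq0 ?mulr0 //.
by rewrite -(leq_add2l (hamming_weight x)) (leq_trans size_p) // addnC
  hamming_weight_antipode.
Qed.

Lemma lambda_ball_le_poly d p l :
  (d < n)%N -> (size p <= d.+1)%N -> -1 < p.[0] ->
  (forall k, (0 < k <= n)%N -> `|p.[k%:R]| <= 1) ->
  is_lambda (pointed_antipodal_ball d) l -> l <= (1 + p.[0])^-1.
Proof.
move=> dn size_p p0 p_le1 [_]; apply.
pose w x : R := (x == 0)%:R + weight_kernel p x.
have walsh_w y :
    walsh w y = 1 + chi R y (const_mx 1) * p.[(hamming_weight y)%:R].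
  by rewrite walshD walsh_delta chi0 walsh_weight_kernel.
have sum_w : \sum_x w x = 1 + p.[0].
  by rewrite -walsh_at0 walsh_w hamming_weight0 chiC chi0 mul1r.
have w0 : w 0 = 1.
  rewrite /w eqxx weight_kernel_eq0 ?addr0 // hamming_weight0.
  exact: leq_trans size_p dn.
apply/ratiosP; exists w; rewrite sum_w w0 mul1r; split=> //; last by lra.
- split=> [|x]; first by exists 0; rewrite w0 oner_eq0.
  rewrite inE negb_or -ltnNge => /andP[/negPf x0 wt_x].
  by rewrite /w x0 weight_kernel_eq0 ?addr0 // (leq_trans _ wt_x) // -addnS
    leq_add2l.
- move=> y; rewrite walsh_w -lerBlDl sub0r.
  have [->|y0] := eqVneq y 0.
    by rewrite hamming_weight0 chiC chi0 mul1r ltW.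
  suff : `|chi R y (const_mx 1) * p.[(hamming_weight y)%:R]| <= 1.
    by rewrite ler_norml => /andP[].
  rewrite normrM norm_chi mul1r p_le1 // hamming_weight_le andbT lt0n.
  by rewrite hamming_weight_eq0.
Qed.

Definition weight_chebyshev d : {poly R} :=
  chebyshev R d \Po ((1 + 2 / n%:R)%:P - (2 / n%:R) *: 'X).

Lemma size_weight_chebyshev d : (size (weight_chebyshev d) <= d.+1)%N.
Proof.
rewrite (leq_trans (size_comp_poly_leq _ _)) // ltnS -[leqRHS]muln1.
rewrite leq_mul //; first by rewrite -subn1 leq_subLR size_chebyshev.
rewrite -subn1 leq_subLR (leq_trans (size_polyD _ _)) // geq_max size_polyN.
rewrite (leq_trans (size_polyC_leq1 _)) //.
by rewrite (leq_trans (size_scale_leq _ _)) // size_polyX.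
Qed.

Lemma horner_weight_chebyshev d t :
  (weight_chebyshev d).[t] = (chebyshev R d).[1 + 2 / n%:R - 2 / n%:R * t].
Proof. by rewrite horner_comp !hornerE. Qed.

Lemma weight_chebyshev_at0_ge d :
  1 + d%:R ^+ 2 * (2 / n%:R) <= (weight_chebyshev d).[0].
Proof.
by rewrite horner_weight_chebyshev mulr0 subr0 chebyshev_ge ?divr_ge0.
Qed.

Lemma norm_weight_chebyshev_le1 d t :
  1 <= t <= n%:R -> `|(weight_chebyshev d).[t]| <= 1.
Proof.
move=> /andP[t_ge1 t_le_n]; have n_gt0 : 0 < n%:R :> R by lra.
rewrite horner_weight_chebyshev norm_chebyshev_le1 //.
have -> : 1 + 2 / n%:R - 2 / n%:R * t = 1 - 2 * ((t - 1) / n%:R) by ring.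
have : 0 <= (t - 1) / n%:R by rewrite divr_ge0 ?subr_ge0 // ltW.
have : (t - 1) / n%:R <= 1 by rewrite ler_pdivrMr // mul1r; lra.
by rewrite ler_norml => ? ?; apply/andP; split; lra.
Qed.

Lemma lambda_ball_le d l :
  (d < n)%N -> is_lambda (pointed_antipodal_ball d) l ->
  l <= (2 + d%:R ^+ 2 * (2 / n%:R))^-1.
Proof.
move=> dn lP; have p0_ge := weight_chebyshev_at0_ge d.
have growth_ge0 : 0 <= d%:R ^+ 2 * (2 / n%:R) :> R.
  by rewrite mulr_ge0 ?sqr_ge0 ?divr_ge0.
have p0_gt : -1 < (weight_chebyshev d).[0] by lra.
have p_le1 k : (0 < k <= n)%N -> `|(weight_chebyshev d).[k%:R]| <= 1.
  by move=> kn; rewrite norm_weight_chebyshev_le1 // ler1n ler_nat.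
have l_le := lambda_ball_le_poly dn (size_weight_chebyshev d) p0_gt p_le1 lP.
apply: le_trans l_le _.
by rewrite lef_pV2 ?posrE; lra.
Qed.

Lemma lambda_pm_ball_ge d l :
  (0 < n)%N -> is_lambda_pm (pointed_antipodal_ball d) l ->
  2^-1 - d%:R / n%:R <= l.
Proof.
move=> n_gt0 [/ratiosP[f [[_ fN fP] f_pd sum_gt0 ->]] _].
have f0_ge0 : 0 <= f 0.
  exact: le_trans (normr_ge0 _) (positive_definite_norm_le 0 f_pd).
have nR_gt0 : 0 < n%:R :> R by rewrite ltr0n.
pose excess x : R := n%:R - d%:R - (hamming_weight x)%:R.
have excess_f_le : \sum_x excess x * f x <= n%:R * f 0.
  rewrite (bigD1 0) //= -[leRHS]addr0 lerD //.
    by rewrite ler_wpM2r // /excess -addrA gerDl -opprD oppr_le0 addr_ge0.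
  apply: sumr_le0 => x x0.
  have [xA|xA] := boolP (x \in pointed_antipodal_ball d).
    rewrite mulr_le0_ge0 ?fP //; move: xA.
    by rewrite inE (negPf x0) /= -(ler_nat R) natrD /excess; lra.
  rewrite mulr_ge0_le0 ?fN //; move: xA.
  by rewrite inE (negPf x0) /= -ltnNge -(ltr_nat R) natrD /excess; lra.
have excess_f_ge : (n%:R / 2 - d%:R) * \sum_x f x <= \sum_x excess x * f x.
  under [leRHS]eq_bigr do rewrite mulrBl.
  rewrite sumrB -mulr_sumr.
  by have := positive_definite_sum_weight f_pd; lra.
rewrite ler_pdivlMr // -(ler_pM2l nR_gt0) mulrA.
have -> : n%:R * (2^-1 - d%:R / n%:R) = n%:R / 2 - d%:R :> R.
  by field; rewrite gt_eqF.
exact: le_trans excess_f_ge excess_f_le.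
Qed.

End PointedAntipodalBall.

Lemma exists_radius (R : archiRealFieldType) (eps : R) : 0 < eps ->
  exists N, forall n, (N <= n)%N -> exists d,
    [/\ (d < n)%N, d%:R / n%:R < eps &
        (2 + d%:R ^+ 2 * (2 / n%:R))^-1 < eps].
Proof.
move=> eps_gt0.
have [m m_gt1 m_eps] : exists2 m : nat, (1 < m)%N & m%:R^-1 < eps.
  exists (Num.bound eps^-1).+2 => //.
  rewrite invf_plt ?posrE //; apply: lt_le_trans (archi_boundP _) _.
    by rewrite invr_ge0 ltW.
  by rewrite ler_nat -addn2 leq_addr.
exists (m ^ 3)%N => n mn; exists (n %/ m)%N; set d := (n %/ m)%N.
have m_gt0 : (0 < m)%N by exact: ltnW.
have dm_le_n : (d * m <= n)%N by exact: leq_divM.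
have n_lt_dm : (n < d.+1 * m)%N by exact: ltn_ceil.
have m2_le_d : (m ^ 2 <= d)%N by rewrite leq_divRL // -expnSr.
have n_gt0 : (0 < n)%N by rewrite (leq_trans _ mn) // expn_gt0 m_gt0.
have nR_gt0 : 0 < n%:R :> R by rewrite ltr0n.
have mn_le_d2 : (m * n <= d ^ 2 * 2)%N by nia.
have growth : m%:R <= d%:R ^+ 2 * (2 / n%:R) :> R.
  by rewrite mulrA ler_pdivlMr // -natrX -!natrM ler_nat.
split; first by nia.
- apply: le_lt_trans m_eps; rewrite ler_pdivrMr // ler_pdivlMl ?ltr0n //.
  by rewrite -natrM ler_nat mulnC.
- apply: lt_trans m_eps; have mR_gt0 : 0 < m%:R :> R by rewrite ltr0n.
  by rewrite ltf_pV2 ?posrE; lra.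
Qed.

Theorem theorem1p6 (R : realType) (eps : R) (eps_gt0 : 0 < eps) :
  exists N : nat, forall n : nat, (N <= n)%N ->
  exists A : {set 'rV['Z_2]_n},
    standard A /\
    exists l lpm : R,
      [/\ is_lambda A l, is_lambda_pm A lpm, l < eps & lpm > 2^-1 - eps].
Proof.
have [N radiusP] := exists_radius eps_gt0.
exists N => n /radiusP[d [d_lt_n radius_small reciprocal_small]].
have A0 := pointed_antipodal_ball0 n d.
exists (pointed_antipodal_ball n d); split; first exact: standard_cube.
have [l lP] := is_lambda_exists R A0.
have [lpm lpmP] := is_lambda_pm_exists R A0.
exists l, lpm; split=> //.
  exact: le_lt_trans (lambda_ball_le d_lt_n lP) _.
apply: lt_le_trans (lambda_pm_ball_ge (leq_ltn_trans _ d_lt_n) lpmP) => //.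
by rewrite ltrD2l ltrN2.
Qed.
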